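(* Let $\mathcal Q=\{1,\dots,p\}$ with its usual order, let $G_1,\dots,G_p$ be finite tournaments and $G=\bigoplus_{i\in\mathcal Q}G_i$. Then for every finite tournament $F$, $$t_{\mathrm{ind}}(F,G)=\frac{1}{(v(G))_{v(F)}}\sum_{(F_i)\in\mathcal P(F,\mathcal Q)}\prod_{i\in\mathcal Q}(v(G_i))_{v(F_i)}\,t_{\mathrm{ind}}(F_i,G_i).$$
   Context: A tournament is a loopless digraph with exactly one edge between any two distinct vertices. For finite tournaments $\bigoplus_{i\in\mathcal Q}G_i$ is the tournament on $\bigsqcup V(G_i)$ keeping the edges of each $G_i$ and with all edges from $V(G_i)$ to $V(G_j)$ for $i<j$. $(n)_k=n(n-1)\cdots(n-k+1)$, $(n)_0=1$. $\mathrm{ind}(F,G)$ is the number of injective maps $V(F)\to V(G)$ preserving edges and non-edges, and $t_{\mathrm{ind}}(F,G)=\mathrm{ind}(F,G)/(v(G))_{v(F)}$; for the empty tournament $t_{\mathrm{ind}}(\emptyset,G)=1$. $\mathcal P(F,\mathcal Q)$ is the set of families $(F_i)_{i\in\mathcal Q}$ of (possibly empty) induced subtournaments of $F$ whose vertex sets partition $V(F)$ and such that $F=\bigoplus_{i\in\mathcal Q}F_i$. *)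

(* Defs.v *)
From HB Require Import structures.
From mathcomp Require Import all_boot all_order all_algebra.
Set Implicit Arguments.
Unset Strict Implicit.
Unset Printing Implicit Defensive.
Import GRing.Theory.

Record tournament := Tournament {
  vertex :> finType;
  edge : rel vertex;
  edge_irr : irreflexive edge;
  (* [(+)] is exclusive or: exactly one of the two orientations is present. *)
  edge_tour : forall x y, x != y -> edge x y (+) edge y x }.

Section Sum.
Variables (p : nat) (G : 'I_p -> tournament).

(* [tagged_as u v] is [tagged v] transported to the part of [u]; it is only
   meaningful, and only used, when [tag u == tag v]. *)
Definition tsum_edge : rel {i : 'I_p & G i} := fun u v =>
  if tag u == tag v then edge (tagged u) (tagged_as u v)
  else (tag u < tag v)%N.

Lemma tsum_irr : irreflexive tsum_edge.
Proof. by case=> i x; rewrite /tsum_edge eqxx tagged_asE edge_irr. Qed.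

Lemma tsum_tour u v : u != v -> tsum_edge u v (+) tsum_edge v u.
Proof.
case: u v => [i x] [j y]; rewrite /tsum_edge /=.
case: (eqVneq i j) => [eij | nij] neq; last first.
  by case: (ltngtP i j) => // /val_inj e; rewrite e eqxx in nij.
case: j / eij y neq => y neq; rewrite !tagged_asE /=.
apply: edge_tour; apply: contra neq => /eqP ->; exact: eqxx.
Qed.

Definition tsum : tournament := Tournament tsum_irr tsum_tour.
End Sum.

Section Induced.
Variables (F : tournament) (A : {set F}).

Definition induced_edge : rel {x : F | x \in A} :=
  fun x y => edge (val x) (val y).

Lemma induced_irr : irreflexive induced_edge.
Proof. by move=> x; exact: edge_irr. Qed.

Lemma induced_tour x y : x != y -> induced_edge x y (+) induced_edge y x.
Proof. by move=> neq; apply: edge_tour. Qed.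

Definition induced : tournament := Tournament induced_irr induced_tour.
End Induced.

Definition ind (F G : tournament) : nat :=
  #|[set f : {ffun F -> G} | injectiveb f &&
      [forall x, forall y, edge x y == edge (f x) (f y)]]|.

(* [n ^_ k] is the falling factorial.  When v(F) > v(G) the quotient is 0 / 0,
   which is 0 in [rat]. *)
Definition t_ind (F G : tournament) : rat :=
  ((ind F G)%:R / (#|G| ^_ #|F|)%:R)%R.

(* A family of induced subtournaments is encoded by its vertex sets.  The
   equality F = (+)_i F_i is between tournaments on the same vertex set: it says
   that the inclusions of the parts carry the edge relation of the sum to the
   one of F. *)
Definition decompositions (F : tournament) (p : nat) :
    {set {ffun 'I_p -> {set F}}} :=
  [set A : {ffun 'I_p -> {set F}} |
    [&& [forall i, forall j, (i != j) ==> [disjoint A i & A j]],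
        \bigcup_i A i == [set: F] &
        [forall u : tsum (fun i => induced (A i)),
         forall v : tsum (fun i => induced (A i)),
           edge u v == edge (val (tagged u)) (val (tagged v))]]].

(* Main.v *)
Require Import Defs.
From HB Require Import structures.
From mathcomp Require Import all_boot all_order all_algebra.

(** An embedding [f] of [F] into the sum splits [V(F)] into the sets [A i] of
    vertices sent to the [i]-th summand.  These sets form a decomposition of
    [F], and an embedding with given parts [A] is the same thing as a family of
    embeddings of the induced subtournaments on [A i] into [G i].  Counting
    embeddings part by part gives
    [ind F (tsum G) = \sum_A \prod_i ind (induced (A i)) (G i)]. *)

Set Implicit Arguments.
Unset Strict Implicit.
Unset Printing Implicit Defensive.

Import GRing.Theory Num.Theory.

Definition edge_preserving (F G : tournament) (f : {ffun F -> G}) : bool :=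
  [forall x, forall y, edge x y == edge (f x) (f y)].

Lemma edge_preservingP (F G : tournament) (f : {ffun F -> G}) :
  reflect (forall x y, edge x y = edge (f x) (f y)) (edge_preserving f).
Proof.
apply: (iffP forallP) => [fE x y|fE x]; first by move/forallP/(_ y)/eqP: (fE x).
by apply/forallP => y; rewrite fE.
Qed.

(** Distinct vertices of a tournament are always joined by an edge; if [f] identified them, that
    edge would go to a loop. *)
Lemma edge_preserving_inj (F G : tournament) (f : {ffun F -> G}) :
  edge_preserving f -> injective f.
Proof.
move=> /edge_preservingP fE x y fxy; apply/eqP/contraT => /edge_tour.
by rewrite !fE fxy edge_irr.
Qed.

Lemma indE (F G : tournament) :
  ind F G = #|[set f : {ffun F -> G} | edge_preserving f]|.
Proof.
apply: eq_card => f; rewrite !inE -/(edge_preserving f).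
by case fE: (edge_preserving f); rewrite ?andbF //= andbT;
  apply/injectiveP/edge_preserving_inj.
Qed.

(** Clearing the denominator is safe even when [F] is larger than [G]: the quotient is then 0 by
    convention, and [ind F G] is 0 by pigeonhole. *)
Lemma ffact_t_ind (F G : tournament) :
  ((#|G| ^_ #|F|)%:R * t_ind F G = (ind F G)%:R)%R.
Proof.
rewrite /t_ind mulrC; have [le_FG | lt_GF] := leqP #|F| #|G|.
  by rewrite divfK // pnatr_eq0 -lt0n ffact_gt0.
suff -> : ind F G = 0 by rewrite mul0r mul0r.
apply/eqP; rewrite indE cards_eq0 -subset0; apply/subsetP => f.
rewrite inE => /edge_preserving_inj/leq_card.
by rewrite leqNgt lt_GF.
Qed.

Lemma edge_Tagged_diag (p : nat) (G : 'I_p -> tournament) i (x y : G i) :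
  @edge (tsum G) (Tagged G x) (Tagged G y) = edge x y.
Proof. by rewrite /= /tsum_edge /= eqxx tagged_asE. Qed.

Lemma edge_Tagged_neq (p : nat) (G : 'I_p -> tournament) i j
    (x : G i) (y : G j) :
  i != j -> @edge (tsum G) (Tagged G x) (Tagged G y) = (i < j).
Proof. by move=> /negPf nij; rewrite /= /tsum_edge /= nij. Qed.

Section Decompositions.
Variables (p : nat) (F : tournament).
Implicit Type A : {ffun 'I_p -> {set F}}.

(** Edges inside one part agree automatically because parts are induced, so the sum condition only
    constrains pairs in different parts. *)
Lemma decompositionsP A :
  reflect [/\ forall i j x, x \in A i -> x \in A j -> i = j,
              forall x, exists i, x \in A i &
              forall i j x y, i != j -> x \in A i -> y \in A j ->
                edge x y = (i < j)]
          (A \in decompositions F p).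
Proof.
rewrite inE; apply: (iffP and3P) => [[dis cov sumE]|[dis cov sumE]].
  split=> [i j x xi xj|x|i j x y nij xi yj].
  - apply/eqP/contraT => nij; move/forallP/(_ i)/forallP/(_ j): dis.
    by rewrite nij => /pred0P/(_ x); rewrite /= xi xj.
  - have: x \in \bigcup_i A i by rewrite (eqP cov) inE.
    by case/bigcupP => i _ xi; exists i.
  - pose T i := induced (A i).
    move/forallP/(_ (Tagged T (Sub x xi : T i))): sumE.
    move/forallP/(_ (Tagged T (Sub y yj : T j)))/eqP => /= <-.
    exact: (@edge_Tagged_neq _ T).
split.
- apply/forallP => i; apply/forallP => j; apply/implyP => nij.
  apply/pred0P => x /=; apply: contraNF nij => /andP[xi xj].
  by apply/eqP/(dis _ _ x).
- apply/eqP/setP => x; rewrite inE; have [i xi] := cov x.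
  by apply/bigcupP; exists i.
- apply/forallP => -[i x]; apply/forallP => -[j y].
  have [eij | nij] := eqVneq i j.
    case: j / eij y => y.
    by rewrite (@edge_Tagged_diag _ (fun i => induced (A i))).
  rewrite (@edge_Tagged_neq _ (fun i => induced (A i))) //=.
  by rewrite (sumE _ _ _ _ nij (valP x) (valP y)).
Qed.

End Decompositions.

Section Parts.
Variables (p : nat) (G : 'I_p -> tournament) (F : tournament).

Definition parts (f : {ffun F -> tsum G}) : {ffun 'I_p -> {set F}} :=
  [ffun i => [set x | tag (f x) == i]].

Lemma in_parts f i x : (x \in parts f i) = (tag (f x) == i).
Proof. by rewrite ffunE inE. Qed.

Lemma parts_decomposition f :
  edge_preserving f -> parts f \in decompositions F p.
Proof.
move=> /edge_preservingP fE; apply/decompositionsP; split.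
- by move=> i j x; rewrite !in_parts => /eqP<- /eqP.
- by move=> x; exists (tag (f x)); rewrite in_parts.
- move=> i j x y nij; rewrite !in_parts fE.
  case: (f x) (f y) => [i' u] [j' v] /= /eqP ei /eqP ej.
  by rewrite -ei -ej in nij *; rewrite /tsum_edge /= (negPf nij).
Qed.

Section Glue.
Variables (A : {ffun 'I_p -> {set F}}) (decA : A \in decompositions F p).

Notation family := {dffun forall i, {ffun induced (A i) -> G i}}.

(** The index is needed as data, with its membership proof, so that [glue] can apply [g i] to a
    vertex of the subtype. *)
Lemma part_index (x : F) : {i | x \in A i}.
Proof. by apply: sigW; have /decompositionsP[_ /(_ x)] := decA. Qed.

Definition glue (g : family) : {ffun F -> tsum G} :=
  [ffun x => let: exist i xi := part_index x in Tagged G (g i (Sub x xi))].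

Lemma glueE (g : family) i (x : induced (A i)) :
  glue g (val x) = Tagged G (g i x).
Proof.
rewrite ffunE; case: (part_index _) => j xj.
have /decompositionsP[/(_ j i _ xj (valP x)) eji _ _] := decA.
(* The parts being disjoint, the chosen index is [i]; the two subtype elements can then differ only
   in their membership proofs. *)
case: i / eji x xj => x xj; congr (Tagged G (g j _)); exact: val_inj.
Qed.

Lemma part_elem (x : F) : exists i (y : induced (A i)), x = val y.
Proof. by have [i xi] := part_index x; exists i, (Sub x xi). Qed.

Lemma glue_inj : injective glue.
Proof.
move=> g h gh; apply/ffunP => i; apply/ffunP => x.
by apply: (@eq_from_Tagged _ G); rewrite -!glueE gh.
Qed.

Lemma parts_glue (g : family) : parts (glue g) = A.
Proof.
apply/ffunP => i; apply/setP => x; rewrite in_parts.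
have [j [y ->]] := part_elem x; rewrite glueE /=.
apply/eqP/idP => [<-|yi]; first exact: (valP y).
by have /decompositionsP[/(_ j i _ (valP y) yi)] := decA.
Qed.

(** Across parts there is nothing to check: the order of the indices decides the edge both in [F]
    and in the sum. *)
Lemma edge_preserving_glue (g : family) :
  edge_preserving (glue g) = [forall i, edge_preserving (g i)].
Proof.
apply/edge_preservingP/forallP => [gE i|gE x y].
  by apply/edge_preservingP => x y; rewrite -edge_Tagged_diag -!glueE -gE.
have [i [{}x ->]] := part_elem x; have [j [{}y ->]] := part_elem y.
rewrite !glueE; have [eij | nij] := eqVneq i j.
  case: j / eij y => y; rewrite edge_Tagged_diag.
  by move/edge_preservingP: (gE i) => <-.
rewrite edge_Tagged_neq //; have /decompositionsP[_ _] := decA.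
exact: (fun sumE => sumE _ _ _ _ nij (valP x) (valP y)).
Qed.

Lemma glue_surj f : parts f = A -> exists g, f = glue g.
Proof.
move=> fA; have tagf i (x : induced (A i)) : tag (f (val x)) = i.
  by apply/eqP; rewrite -in_parts fA (valP x).
(* The restriction of [f] to [A i], with values transported into [G i] along [tagf]. *)
exists [ffun i => [ffun x => etagged (tagf i x)]].
apply/ffunP => x; have [i [{}x ->]] := part_elem x.
by rewrite glueE !ffunE etaggedK.
Qed.

(** [glue] is a bijection onto this set from the product of the sets of embeddings of the single
    parts. *)
Lemma card_edge_preserving_parts :
  #|[set f : {ffun F -> tsum G} | edge_preserving f & parts f == A]|
  = \prod_(i < p) ind (induced (A i)) (G i).
Proof.
under eq_bigr do rewrite indE.
rewrite -cardsXn -(card_imset _ glue_inj); apply: eq_card => f.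
rewrite inE; apply/andP/imsetP => [[fE /eqP/glue_surj[g fg]]|[g gE ->]].
  exists g => //; apply/setXnP => i; rewrite inE.
  by move: fE; rewrite fg edge_preserving_glue => /forallP.
rewrite parts_glue eqxx edge_preserving_glue; split=> //.
by apply/forallP => i; move/setXnP/(_ i): gE; rewrite inE.
Qed.

End Glue.

Lemma ind_tsum :
  ind F (tsum G) =
  \sum_(A in decompositions F p) \prod_(i < p) ind (induced (A i)) (G i).
Proof.
rewrite indE -sum1_card.
(* Embeddings are grouped by the decomposition they induce. *)
rewrite (partition_big parts [in decompositions F p]) => [|f]; last first.
  by rewrite inE; apply: parts_decomposition.
apply: eq_bigr => A decA; rewrite -(card_edge_preserving_parts decA) -sum1_card.
by apply: eq_bigl => f; rewrite !inE.
Qed.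

End Parts.

Theorem theorem3p9 (p : nat) (G : 'I_p -> tournament) (F : tournament) :
  (t_ind F (tsum G) =
   1 / (#|tsum G| ^_ #|F|)%:R *
   \sum_(A in decompositions F p)
     \prod_(i < p)
       ((#|G i| ^_ #|induced (A i)|)%:R * t_ind (induced (A i)) (G i)))%R.
Proof.
rewrite {1}/t_ind ind_tsum natr_sum mul1r mulrC; congr (_ * _)%R.
apply: eq_bigr => A _; rewrite natr_prod; apply: eq_bigr => i _.
by rewrite ffact_t_ind.
Qed.
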